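(* Let $M>0$ be an integer and let ${A}$ be a deterministic projective $M$-regular list update algorithm over a finite set $L$ of at least three list items (with a fixed initial list state), described by its state function $S$. Then there exists a function $F:U\to\mathbb{N}$ with $F(x^i)\le i$ for all $x^i\in U$ such that the following holds: for any two distinct items $x,y\in L$ and any request sequence $\sigma$ with $|\sigma_x|\ge M$ and $|\sigma_y|\ge M$, setting $q=F(\sigma_x)$ and $l=F(\sigma_y)$, we have $S_{xy}(\sigma)=[xy]$ if $x_{(q)}$ is requested after $y_{(l)}$ in $\sigma$, and $S_{xy}(\sigma)=[yx]$ if $x_{(q)}$ is requested before $y_{(l)}$ in $\sigma$.
   Context: List update problem: a list state is a linear order of the finite item set $L$, written $[x_1\ldots x_n]$ with $x_1$ at the front. A request sequence is a finite word over $L$. A deterministic algorithm with fixed initial list is identified with the function $S$ mapping each finite request sequence $\sigma$ to the list state $S(\sigma)$ after serving $\sigma$. For items $x,y$, $\sigma_{xy}$ (resp. $\sigma_x$) is the subsequence of $\sigma$ of requests to $x$ or $y$ (resp. to $x$), and $S_{xy}(\sigma)\in\{[xy],[yx]\}$ is the relative order of $x,y$ in $S(\sigma)$. The algorithm is projective if $S_{xy}(\sigma)=S_{xy}(\sigma_{xy})$ for all $x,y,\sigma$. It is $M$-regular if for every item $x$ and every request sequence $\sigma$, item $x$ is at the front of the list $S(\sigma x^M)$, where $x^M$ denotes $M$ consecutive requests to $x$. A unary projection $x^i$ is the sequence of $i\ge0$ requests to $x$; $U=\{x^i:x\in L,i\ge0\}$, with $x^0\ne y^0$ for $x\ne y$.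 If $\sigma_x=x^i$, $x_{(q)}$ is the $q$th request to $x$ in $\sigma$. *)

(* Defs.v *)
From mathcomp Require Import all_boot.

Set Implicit Arguments.
Unset Strict Implicit.
Unset Printing Implicit Defensive.

(* A linear order of the finite set L, front item first. *)
Definition list_state (L : finType) := {s : seq L | perm_eq s (enum L)}.

(* S s is the list state after serving s; in particular S [::] is the initial
   list state. *)
Definition algorithm (L : finType) := seq L -> list_state L.

(* The pair (x, i) stands for x^i, so that x^0 and y^0 differ for x <> y. *)
Definition unary (L : finType) := (L * nat)%type.

Section ListUpdate.
Variable L : finType.
Implicit Types (x y : L) (s : seq L) (S : algorithm L).

Definition restr1 x s : seq L := [seq z <- s | z == x].

Definition restr2 x y s : seq L := [seq z <- s | (z == x) || (z == y)].

Definition unary_proj x s : unary L := (x, size (restr1 x s)).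

(* For x <> y this is either [:: x; y] or [:: y; x]. *)
Definition pair_order S x y s : seq L := restr2 x y (val (S s)).

Definition projective S : Prop :=
  forall x y s, pair_order S x y s = pair_order S x y (restr2 x y s).

Definition regular (M : nat) S : Prop :=
  forall x s, ohead (val (S (s ++ nseq M x))) = Some x.

(* The entry of s at the 0-based position p is the q-th request to x, where q
   is counted from 1: this is false for every p when q = 0 or q exceeds the
   number of requests to x. *)
Definition is_request x (q : nat) s (p : nat) : Prop :=
  onth s p = Some x /\ size (restr1 x (take p.+1 s)) = q.

End ListUpdate.

(* Main.v *)
Require Import Defs.
From mathcomp Require Import all_boot.

(** If [z] is requested [M] times in a row inside [x^i], say after the first
    [a] requests to [x], a third item shows that "[x] precedes [z]" is
    downward closed in [a] and independent of [z]: insert two such blocks, for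
    distinct [y] and [z]; the item of the later block precedes the other one by
    regularity.  The threshold on [a] is [F (x^i)].  In a sequence where the
    critical request to [x] comes after that to [y], a block [z^M] placed right
    before the former puts [x] in front of [z] and [z] in front of [y]. *)

Set Implicit Arguments.
Unset Strict Implicit.
Unset Printing Implicit Defensive.

Section Restriction.
Variable L : finType.
Implicit Types (x y z : L) (s t : seq L).

Lemma restr1_nseq x s : restr1 x s = nseq (size (restr1 x s)) x.
Proof. by apply/all_pred1P; apply: filter_all. Qed.

Lemma restr1_cat x s t : restr1 x (s ++ t) = restr1 x s ++ restr1 x t.
Proof. exact: filter_cat. Qed.

Lemma restr2_cat x y s t : restr2 x y (s ++ t) = restr2 x y s ++ restr2 x y t.
Proof. exact: filter_cat. Qed.

Lemma restr2_nseq x y z n :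
  restr2 x y (nseq n z) = if (z == x) || (z == y) then nseq n z else [::].
Proof. by rewrite /restr2 filter_nseq; case: (_ || _); rewrite ?mul1n. Qed.

Lemma restr2C x y s : restr2 x y s = restr2 y x s.
Proof. by apply: eq_filter => w; rewrite orbC. Qed.

Lemma restr2_id x y s : restr2 x y (restr2 x y s) = restr2 x y s.
Proof. by apply: filter_id. Qed.

Lemma restr2_restr2 x y z s :
  y != z -> restr2 x z (restr2 x y s) = restr1 x s.
Proof.
move=> yz; rewrite /restr2 /restr1 -filter_predI; apply: eq_filter => w /=.
by case: (w == x) => //=; case: (eqVneq w y) => [->|]; rewrite ?andbF // (negPf yz).
Qed.

Lemma restr2_index_lt x y s : uniq s -> x \in s -> y \in s ->
  index x s < index y s -> restr2 x y s = [:: x; y].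
Proof.
move=> + /path.splitPr xs; case: xs => s1 s2.
rewrite uniq_catC /= mem_cat negb_or => /andP[/andP[xs2 xs1] Us].
rewrite mem_cat inE !index_cat (negPf xs1) /= eqxx addn0.
case: ifP => [ys1 _ | ys1 /=]; first by rewrite ltnNge index_size.
rewrite [x == y]eq_sym; case: (eqVneq y x) => [-> | yx /= ys2 _].
  by rewrite addn0 ltnn.
have Us2 : uniq s2 by move: Us; rewrite cat_uniq => /and3P[].
(* With [s] split around [x], the prefix [s1] contains neither item, and [s2] contains [y] exactly
   once and no [x]. *)
rewrite /restr2 filter_cat /= eqxx /= (eq_in_filter (a2 := pred0)); last first.
  by move=> w ws1 /=; apply: contraTF ws1 => /orP[] /eqP->; rewrite ?xs1 ?ys1.
rewrite filter_pred0 /= (eq_in_filter (a2 := pred1 y)) ?filter_pred1_uniq //.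
by move=> w ws2 /=; case: eqVneq ws2 => // ->; rewrite (negPf xs2).
Qed.

Lemma restr2_index x y s : uniq s -> x \in s -> y \in s -> x != y ->
  restr2 x y s = if index x s < index y s then [:: x; y] else [:: y; x].
Proof.
move=> Us xs ys xy; case: ltngtP => [||exy].
- exact: restr2_index_lt.
- by rewrite restr2C; apply: restr2_index_lt.
- by rewrite (index_inj x xs ys exy) eqxx in xy.
Qed.

Lemma is_request_exists x q s :
  0 < q <= size (restr1 x s) -> exists p, is_request x q s p.
Proof.
elim/last_ind: s => [|s w IH]; first by case: q.
rewrite -cats1 restr1_cat size_cat /= => /andP[q0 qs].
have [qle|qgt] := leqP q (size (restr1 x s)).
  have [|p [onp szp]] := IH; first by rewrite q0.
  have ps : p < size s by rewrite -onthTE onp.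
  exists p; split; first by rewrite onth_cat ps.
  by rewrite takel_cat.
(* Here [q] exceeds the number of requests to [x] in [s], so the last letter [w] has to be the
   request sought. *)
exists (size s); case: (eqVneq w x) qs => [->|wx] /= qs; last first.
  by move: qs; rewrite addn0 leqNgt qgt.
split; first by rewrite onth_cat ltnn subnn.
rewrite take_oversize ?size_cat ?addn1 // restr1_cat size_cat /= eqxx addn1.
by apply/eqP; rewrite eqn_leq qgt -addn1.
Qed.

Lemma leq_size_restr1_take x s m n :
  m <= n -> size (restr1 x (take m s)) <= size (restr1 x (take n s)).
Proof.
move=> mn; rewrite -(subnKC mn) -[s in X in _ <= X](cat_take_drop m).
by rewrite takeD !restr1_cat !size_cat cat_take_drop leq_addr.
Qed.

Lemma is_request_take x q s p :
  is_request x q s p -> size (restr1 x (take p s)) < q.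
Proof.
case=> onp <-; have ps : p < size s by rewrite -onthTE onp.
rewrite (take_nth x ps) (onth_nth x x s p onp) -cats1 restr1_cat.
by rewrite size_cat /= eqxx addn1.
Qed.

End Restriction.

Section CriticalRequests.
Variables (M : nat) (L : finType) (S : algorithm L).
Hypothesis hL : 3 <= #|L|.
Hypotheses (hproj : projective S) (hreg : regular M S).
Implicit Types (x y z : L) (s t u v : seq L).

(** Comparing positions in the whole list makes transitivity immediate. *)
Definition precedes x y s := index x (val (S s)) < index y (val (S s)).

Lemma pair_orderE x y s : x != y ->
  pair_order S x y s = if precedes x y s then [:: x; y] else [:: y; x].
Proof.
move=> xy; have p := valP (S s).
by apply: restr2_index; rewrite ?(perm_uniq p) ?enum_uniq ?(perm_mem p) ?mem_enum.
Qed.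

Lemma precedes_trans x y z s : precedes x y s -> precedes y z s -> precedes x z s.
Proof. exact: ltn_trans. Qed.

Lemma precedesN x y s : x != y -> ~~ precedes x y s = precedes y x s.
Proof.
move=> xy; rewrite /precedes -leqNgt leq_eqVlt; case: eqVneq => //= exy.
have in_S z : z \in val (S s) by rewrite (perm_mem (valP (S s))) mem_enum.
by rewrite (index_inj x (in_S y) (in_S x) exy) eqxx in xy.
Qed.

(** Projectivity in its working form: a sequence may be traded for any other with the same
    projection to the pair. *)
Lemma precedes_restr2 x y s t : x != y ->
  restr2 x y s = restr2 x y t -> precedes x y s = precedes x y t.
Proof.
move=> xy est; have := hproj x y s; rewrite est -hproj !pair_orderE //.
by do 2!case: precedes => //; case=> exy; rewrite exy eqxx in xy.
Qed.

Lemma precedes_nseq x y s : x != y -> precedes x y (s ++ nseq M x).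
Proof.
move=> xy; have := hreg x s; rewrite /precedes.
by case: (val _) => //= a r [->]; rewrite eqxx (negPf xy).
Qed.

(** The case [x = y] is allowed and supplies a single other item in [critical_gt0]. *)
Lemma third_item x y : exists2 z, z != x & z != y.
Proof.
have /card_gt0P[z] : 0 < #|~: [set x; y]|.
  rewrite cardsCs setCK subn_gt0 (leq_trans _ hL) // ltnS cards2.
  by case: (x != y).
by rewrite !inE negb_or => /andP[]; exists z.
Qed.

Definition block_word x z i a := nseq a x ++ nseq M z ++ nseq (i - a) x.

Lemma precedes_block_down x y z i a b : x != y -> x != z -> y != z ->
  b <= a <= i -> precedes x z (block_word x z i a) ->
  precedes x y (block_word x y i b).
Proof.
move=> xy xz yz /andP[ba ai] xza.
have yx : y != x by rewrite eq_sym.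
have zx : z != x by rewrite eq_sym.
have zy : z != y by rewrite eq_sym.
(* The pairs [x, z] and [x, y] see only their own block words in [w], while [y, z] see [y^M z^M],
   which leaves [z] in front of [y]. *)
pose w := nseq b x ++ nseq M y ++ nseq (a - b) x ++ nseq M z ++ nseq (i - a) x.
have wxz : precedes x z w.
  rewrite (precedes_restr2 xz (t := block_word x z i a)) //.
  rewrite /w /block_word !restr2_cat !restr2_nseq !eqxx ?orbT /=.
  by rewrite (negPf yx) (negPf yz) /= catA -nseqD subnKC.
have wzy : precedes z y w.
  rewrite (precedes_restr2 zy (t := nseq M y ++ nseq M z)) ?precedes_nseq //.
  rewrite /w !restr2_cat !restr2_nseq !eqxx ?orbT /=.
  by rewrite (negPf xy) (negPf xz) /= cats0.
rewrite (precedes_restr2 xy (t := w)) ?(precedes_trans wxz wzy) //.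
rewrite /w /block_word !restr2_cat !restr2_nseq !eqxx ?orbT /=.
by rewrite (negPf zx) (negPf zy) /= -nseqD addnC addnBA // subnK.
Qed.

(** The search stops at the first [a < i] where [x] fails to precede [z]. If there is none, [find]
    returns [i], which is the right threshold: [x^i z^M] leaves [z] in front. The choice of [z] is
    immaterial by [precedes_block]. *)
Definition critical (p : unary L) : nat :=
  let: (x, i) := p in
  if [pick z | x != z] is Some z then
    find (fun a => ~~ precedes x z (block_word x z i a)) (iota 0 i)
  else 0.

Lemma critical_le x i : critical (x, i) <= i.
Proof.
rewrite /critical; case: pickP => // z _.
by rewrite -[leqRHS](size_iota 0 i) find_size.
Qed.

Lemma precedes_block x z i a : x != z -> a <= i ->
  precedes x z (block_word x z i a) = (a < critical (x, i)).
Proof.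
move=> xz ai; have := critical_le x i; rewrite /critical.
case: pickP => [y xy | /(_ z)]; last by rewrite xz.
have -> : precedes x z (block_word x z i a) = precedes x y (block_word x y i a).
  have [<- //|zy] := eqVneq z y; have yz : y != z by rewrite eq_sym.
  by apply/idP/idP; apply: precedes_block_down; rewrite ?leqnn.
set P := fun a => ~~ _; set F := find P _ => Fi.
apply/idP/idP => [|aF].
  apply: contraTltn => Fa.
  (* The predicate [P] also holds at the default value [F = i], by regularity, since the word then
     ends in the block. *)
  have PF : P F.
    move: Fi; rewrite leq_eqVlt => /predU1P[->|Fi].
      rewrite /P /block_word subnn cats0 precedesN //.
      by rewrite precedes_nseq // eq_sym.
    have hasP : has P (iota 0 i) by rewrite has_find size_iota.
    by have := nth_find 0 hasP; rewrite nth_iota.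
  (* [precedes_block_down] always changes the block item, so descending from [a] to [F] with the
     same [y] takes a detour through [z']. *)
  have [z' z'x z'y] := third_item x y.
  have xz' : x != z' by rewrite eq_sym.
  have yz' : y != z' by rewrite eq_sym.
  apply: contra PF => xya.
  apply: (@precedes_block_down x y z' i F F) => //; first by rewrite leqnn.
  by apply: (@precedes_block_down x z' y i a F) => //; rewrite Fa.
have := before_find 0 aF; rewrite nth_iota; last exact: leq_trans Fi.
by move/negbFE.
Qed.

(** A block placed before all requests to [x] is followed by at least [M] of them, so [a = 0] lies
    below the threshold. This excludes the index 0, which designates no request. *)
Lemma critical_gt0 x i : M <= i -> 0 < critical (x, i).
Proof.
move=> Mi; have [z zx _] := third_item x x; have xz : x != z by rewrite eq_sym.
rewrite -(precedes_block xz) // /block_word subn0 cat0s -(subnK Mi) nseqD catA.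
exact: precedes_nseq.
Qed.

Lemma precedes_critical x y u v : x != y ->
  size (restr1 x u) < critical (unary_proj x (u ++ v)) ->
  critical (unary_proj y (u ++ v)) <= size (restr1 y u) ->
  precedes x y (u ++ v).
Proof.
move=> xy; rewrite /unary_proj !restr1_cat !size_cat => xu yu.
have [z zx zy] := third_item x y.
have xz : x != z by rewrite eq_sym.
have yz : y != z by rewrite eq_sym.
(* Projecting [u] and [v] first removes any requests to [z] in them, which would spoil the block
   words. *)
pose w := restr2 x y u ++ nseq M z ++ restr2 x y v.
have wxz : precedes x z w.
  rewrite (precedes_restr2 xz (t := block_word x z
    (size (restr1 x u) + size (restr1 x v)) (size (restr1 x u)))) ?precedes_block ?leq_addr //.
  rewrite /w /block_word addKn !restr2_cat !restr2_nseq !restr2_restr2 1?eq_sym //.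
  by rewrite !eqxx ?orbT -!restr1_nseq.
have wzy : precedes z y w.
  rewrite -precedesN // (precedes_restr2 yz (t := block_word y z
    (size (restr1 y u) + size (restr1 y v)) (size (restr1 y u)))).
    by rewrite precedes_block ?leq_addr // -leqNgt.
  rewrite /w /block_word addKn !restr2_cat !restr2_nseq !(restr2C x y).
  rewrite !restr2_restr2 1?eq_sym //.
  by rewrite !eqxx ?orbT -!restr1_nseq.
rewrite (precedes_restr2 xy (t := w)) ?(precedes_trans wxz wzy) //.
by rewrite /w !restr2_cat !restr2_id restr2_nseq (negPf zx) (negPf zy).
Qed.

End CriticalRequests.

Theorem theorem12 (M : nat) (hM : 0 < M) (L : finType) (hL : 3 <= #|L|)
    (S : algorithm L) (hproj : projective S) (hreg : regular M S) :
  exists F : unary L -> nat,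
    (forall (x : L) (i : nat), F (x, i) <= i) /\
    (forall (x y : L) (s : seq L), x <> y ->
       M <= size (restr1 x s) -> M <= size (restr1 y s) ->
       let q := F (unary_proj x s) in
       let l := F (unary_proj y s) in
       exists p r : nat,
         [/\ is_request x q s p, is_request y l s r,
             r < p -> pair_order S x y s = [:: x; y] &
             p < r -> pair_order S x y s = [:: y; x]]).
Proof.
exists (critical M S); split=> [x i|x y s /eqP xy xM yM q l]; first exact: critical_le.
have [p xp] : exists p, is_request x q s p.
  by apply: is_request_exists; rewrite critical_gt0 // critical_le.
have [r yr] : exists r, is_request y l s r.
  by apply: is_request_exists; rewrite critical_gt0 // critical_le.
have later v w n m : v != w -> is_request v (critical M S (unary_proj v s)) s n ->
    is_request w (critical M S (unary_proj w s)) s m -> m < n -> precedes S v w s.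
  (* Cutting at position [n] leaves the critical request to [v] out of the prefix and keeps that to
     [w] in it, hence one strict and one weak bound. *)
  move=> vw vn [_ wm] mn; rewrite -(cat_take_drop n s).
  apply: (@precedes_critical M) => //; rewrite cat_take_drop.
    exact: is_request_take.
  by rewrite -wm leq_size_restr1_take.
exists p, r; split=> // pr; rewrite pair_orderE //; first by rewrite (later x y p r).
by rewrite ifN // precedesN // (later y x r p) // eq_sym.
Qed.
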